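(* Let $\varkappa\neq0$ and consider a discontinuity moving with constant speed $\mathcal{D}$ and separating two constant states $(\rho_L,u_L,\eta_L,j_L)$ and $(\rho_R,u_R,\eta_R,j_R)$, with $\rho_{L},\rho_R>0$, satisfying the Rankine–Hugoniot conditions $$[\mathcal{M}]=0,\qquad\Big[p+\frac{\mathcal{M}^2}{\rho}\Big]=0,\qquad \Big[\mathcal{M}\frac{j}{\rho}+\theta\Big]=0,$$ $$\Big[\mathcal{M}\Big(\frac{\mathcal{M}^2}{2\rho^2}+\varepsilon+\frac{p}{\rho}+\frac12\frac{\varkappa^2}{\rho^2}j^2\Big)+\frac{\varkappa^2}{\rho}\theta j\Big]=0,$$ where $\mathcal{M}=\rho(u-\mathcal{D})$. If $\mathcal{M}=0$, then $[\rho]=0$, $[u]=0$, $[\eta]=0$ and $[j]=0$. That is, no contact discontinuities are admissible.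
   Context: $[g]=g_R-g_L$ denotes the jump of $g$. $\varepsilon(\rho,\eta)$ is a smooth specific internal energy which, as a function of $(v,\eta)$ with $v=1/\rho$, is convex on $\{v>0\}\times\mathbb{R}$ with positive definite Hessian; $p=\rho^2\,\partial\varepsilon/\partial\rho$ is the pressure and $\theta=\partial\varepsilon/\partial\eta>0$ the temperature. The Rankine–Hugoniot conditions express conservation of mass, momentum, $j$ and total energy for the one-dimensional system $\partial_t\rho+\partial_x(\rho u)=0$, $\partial_t(\rho u)+\partial_x(\rho u^2+p)=0$, $\partial_tj+\partial_x(ju+\theta)=0$, $\partial_tE+\partial_x(Eu+pu+\frac{\varkappa^2}{\rho}\theta j)=0$, with $E=\frac12\rho u^2+\rho\varepsilon+\frac{\varkappa^2}{2\rho}j^2$. A contact discontinuity is a discontinuity with $\mathcal{M}=0$. *)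

(* Defs.v *)
From Stdlib Require Export Reals.
From Coquelicot Require Export Coquelicot.
Open Scope R_scope.

Definition d1 (f : R -> R -> R) (x y : R) : R := Derive (fun s => f s y) x.
Definition d2 (f : R -> R -> R) (x y : R) : R := Derive (fun s => f x s) y.

(* [ex_diff_n f n x y] is a pointwise condition; required for all [n] at every
   point of the open half-plane, it says that [f] is C^infinity there. *)
Definition smooth_half_plane (f : R -> R -> R) : Prop :=
  forall (n : nat) (x y : R), 0 < x -> ex_diff_n f n x y.

Definition convex_half_plane (f : R -> R -> R) : Prop :=
  forall x1 y1 x2 y2 t : R, 0 < x1 -> 0 < x2 -> 0 <= t <= 1 ->
    f (t * x1 + (1 - t) * x2) (t * y1 + (1 - t) * y2)
      <= t * f x1 y1 + (1 - t) * f x2 y2.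

Definition hessian_pos_def (f : R -> R -> R) (x y : R) : Prop :=
  forall h k : R, (h, k) <> (0, 0) ->
    0 < d1 (d1 f) x y * h * h + d1 (d2 f) x y * h * k
        + d2 (d1 f) x y * k * h + d2 (d2 f) x y * k * k.

(* Thermodynamics: [eps] is a function of [(rho, eta)]. *)

Definition in_specific_volume (eps : R -> R -> R) (v eta : R) : R :=
  eps (/ v) eta.

Definition pressure (eps : R -> R -> R) (rho eta : R) : R :=
  rho ^ 2 * d1 eps rho eta.

Definition temperature (eps : R -> R -> R) (rho eta : R) : R :=
  d2 eps rho eta.

Record specific_internal_energy (eps : R -> R -> R) : Prop := {
  energy_smooth : smooth_half_plane eps;
  energy_convex : convex_half_plane (in_specific_volume eps);
  energy_hessian : forall v eta : R, 0 < v ->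
    hessian_pos_def (in_specific_volume eps) v eta;
  energy_temperature : forall rho eta : R, 0 < rho ->
    0 < temperature eps rho eta }.

(* The components are rho, u, eta and j; positivity of the density is not part
   of the type. *)
Record state : Type := State {
  density : R;
  velocity : R;
  entropy : R;
  thermal_j : R }.

Definition jump (g : state -> R) (SL SR : state) : R := g SR - g SL.

Definition energy_of (eps : R -> R -> R) (S : state) : R :=
  eps (density S) (entropy S).
Definition pressure_of (eps : R -> R -> R) (S : state) : R :=
  pressure eps (density S) (entropy S).
Definition temperature_of (eps : R -> R -> R) (S : state) : R :=
  temperature eps (density S) (entropy S).

Definition mass_flux (D : R) (S : state) : R :=
  density S * (velocity S - D).

(* Fluxes of momentum, of j and of total energy relative to the discontinuity,
   after the use of [jump (mass_flux D) SL SR = 0]. *)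

Definition momentum_flux (eps : R -> R -> R) (D : R) (S : state) : R :=
  pressure_of eps S + mass_flux D S ^ 2 / density S.

Definition j_flux (eps : R -> R -> R) (D : R) (S : state) : R :=
  mass_flux D S * (thermal_j S / density S) + temperature_of eps S.

Definition energy_flux (kappa : R) (eps : R -> R -> R) (D : R) (S : state) : R :=
  mass_flux D S *
    (mass_flux D S ^ 2 / (2 * density S ^ 2)
     + energy_of eps S
     + pressure_of eps S / density S
     + / 2 * (kappa ^ 2 / density S ^ 2) * thermal_j S ^ 2)
  + kappa ^ 2 / density S * temperature_of eps S * thermal_j S.

Definition rankine_hugoniot (kappa : R) (eps : R -> R -> R) (D : R)
    (SL SR : state) : Prop :=
  jump (mass_flux D) SL SR = 0 /\
  jump (momentum_flux eps D) SL SR = 0 /\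
  jump (j_flux eps D) SL SR = 0 /\
  jump (energy_flux kappa eps D) SL SR = 0.

Definition contact_discontinuity (D : R) (SL SR : state) : Prop :=
  SL <> SR /\ mass_flux D SL = 0 /\ mass_flux D SR = 0.

(* Main.v *)
Require Import Defs.
From Stdlib Require Import Lra.

(** When the mass flux vanishes on both sides, the velocity equals the speed of
    the discontinuity on both sides, and the remaining jump conditions reduce to
    the continuity of the pressure, of the temperature and of
    [kappa ^ 2 / rho * theta * j].  In the variables [(v, eta)] with
    [v = 1 / rho], the pair (minus pressure, temperature) is the gradient of the
    specific internal energy [e] ([d1_in_specific_volume],
    [d2_in_specific_volume]).  The gradient of a function with positive definite
    Hessian on the half-plane is strictly monotone
    ([gradient_strictly_monotone]), hence injective, so pressure and temperature
    determine the specific volume and the entropy.  The two densities and the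
    two entropies therefore coincide, and since [kappa] and the temperature do
    not vanish, the last jump condition gives the equality of the [j].

    Strict monotonicity follows from the mean value theorem along the segment
    joining two points, which needs the two components of the gradient of [e] to
    be differentiable in both variables jointly.  This is deduced from the
    smoothness of the energy in [(rho, eta)] by the chain rule. *)

(** * Differentiability in two variables *)

(** The classical criterion in its asymmetric form: continuity of one partial
    derivative, together with mere existence of the other at the point, suffices
    for differentiability in both variables jointly. *)
Lemma differentiable_of_C1 (f g : R -> R -> R) (x y l : R) :
  locally_2d (fun u v => is_derive (fun z => f z v) u (g u v)) x y ->
  is_derive (fun z => f x z) y l ->
  continuity_2d_pt g x y ->
  differentiable_pt_lim f x y (g x y) l.
Proof.
  intros Hx Hy Hg.
  apply filterdiff_differentiable_pt_lim.
  apply (is_derive_filterdiff f x y g l).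
  - now apply locally_2d_locally in Hx.
  - exact Hy.
  - now apply continuity_2d_pt_filterlim.
Qed.

Lemma locally_half_plane (x y : R) :
  0 < x -> locally_2d (fun u _ => 0 < u) x y.
Proof.
  intros Hx; exists (mkposreal x Hx); simpl; intros u v Hu _.
  apply Rabs_def2 in Hu; lra.
Qed.

Lemma smooth_differentiable (f : R -> R -> R) (x y : R) :
  smooth_half_plane f -> 0 < x ->
  differentiable_pt_lim f x y (d1 f x y) (d2 f x y).
Proof.
  intros Hf Hx.
  apply differentiable_of_C1.
  - eapply locally_2d_impl; [| exact (locally_half_plane x y Hx)].
    apply locally_2d_forall; intros u v Hu.
    destruct (Hf 1%nat u v Hu) as [_ [H _]].
    now apply Derive_correct.
  - destruct (Hf 1%nat x y Hx) as [_ [_ [H _]]].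
    now apply Derive_correct.
  - destruct (Hf 1%nat x y Hx) as [_ [_ [_ [[H _] _]]]].
    exact H.
Qed.

Lemma smooth_differentiable_pt (g : R -> R -> R) (x y : R) :
  smooth_half_plane g -> 0 < x -> differentiable_pt g x y.
Proof.
  intros Hg Hx; exists (d1 g x y), (d2 g x y); now apply smooth_differentiable.
Qed.

Lemma smooth_d1 (f : R -> R -> R) :
  smooth_half_plane f -> smooth_half_plane (d1 f).
Proof.
  intros Hf n x y Hx; now destruct (Hf (S n) x y Hx) as [_ [_ [_ [H _]]]].
Qed.

Lemma smooth_d2 (f : R -> R -> R) :
  smooth_half_plane f -> smooth_half_plane (d2 f).
Proof.
  intros Hf n x y Hx; now destruct (Hf (S n) x y Hx) as [_ [_ [_ [_ H]]]].
Qed.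

(** Turns an existence statement into one about the iterated partial derivatives
    that occur in the Hessian, so that the coefficients produced by the chain
    rule never have to be computed. *)
Lemma differentiable_pt_partials (f : R -> R -> R) (x y : R) :
  differentiable_pt f x y ->
  differentiable_pt_lim f x y (d1 f x y) (d2 f x y).
Proof.
  intros [lx [ly H]].
  destruct (differentiable_pt_lim_unique _ _ _ _ _ H) as [Ex Ey].
  unfold d1, d2; now rewrite Ex, Ey.
Qed.

Lemma differentiable_pt_ext_half_plane (f g : R -> R -> R) (x y : R) :
  (forall u v, 0 < u -> f u v = g u v) -> 0 < x ->
  differentiable_pt f x y -> differentiable_pt g x y.
Proof.
  intros E Hx [lx [ly H]]; exists lx, ly.
  apply differentiable_pt_lim_ext with (2 := H).
  eapply locally_2d_impl; [| exact (locally_half_plane x y Hx)].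
  now apply locally_2d_forall; intros u v; apply E.
Qed.

(** * Monotonicity of the gradient *)

(** Along the segment from [(x1, y1)] to [(x2, y2)], the derivative of the
    component of the gradient in the direction of the segment is the Hessian
    form evaluated at that direction. *)
Lemma gradient_strictly_monotone (f : R -> R -> R) :
  (forall x y, 0 < x -> differentiable_pt (d1 f) x y) ->
  (forall x y, 0 < x -> differentiable_pt (d2 f) x y) ->
  (forall x y, 0 < x -> hessian_pos_def f x y) ->
  forall x1 y1 x2 y2 : R, 0 < x1 -> 0 < x2 ->
    (x2 - x1, y2 - y1) <> (0, 0) ->
    0 < (d1 f x2 y2 - d1 f x1 y1) * (x2 - x1)
        + (d2 f x2 y2 - d2 f x1 y1) * (y2 - y1).
Proof.
  intros Hd1 Hd2 Hpos x1 y1 x2 y2 Hx1 Hx2 Hne.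
  set (a := x2 - x1) in *; set (b := y2 - y1) in *.
  set (X := fun t : R => x1 + t * a); set (Y := fun t : R => y1 + t * b).
  assert (HX : forall t, 0 <= t <= 1 -> 0 < X t).
  { intros t Ht; unfold X, a.
    replace (x1 + t * (x2 - x1)) with ((1 - t) * x1 + t * x2) by ring.
    destruct (Rle_dec t (1 / 2)) as [Hle | Hgt].
    - apply Rplus_lt_le_0_compat;
        [apply Rmult_lt_0_compat | apply Rmult_le_pos]; lra.
    - apply Rplus_le_lt_0_compat;
        [apply Rmult_le_pos | apply Rmult_lt_0_compat]; lra. }
  assert (HX' : forall t, derivable_pt_lim X t a)
    by (intro t; apply is_derive_Reals; unfold X; auto_derive; [easy | ring]).
  assert (HY' : forall t, derivable_pt_lim Y t b)
    by (intro t; apply is_derive_Reals; unfold Y; auto_derive; [easy | ring]).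
  set (h := fun t => d1 f (X t) (Y t) * a + d2 f (X t) (Y t) * b).
  set (h' := fun t => (d1 (d1 f) (X t) (Y t) * a + d2 (d1 f) (X t) (Y t) * b) * a
                    + (d1 (d2 f) (X t) (Y t) * a + d2 (d2 f) (X t) (Y t) * b) * b).
  destruct (MVT_cor2 h h' 0 1 Rlt_0_1) as [c [Hc Hc01]].
  { intros t Ht.
    assert (D : forall g, differentiable_pt g (X t) (Y t) ->
      derivable_pt_lim (fun s => g (X s) (Y s)) t
        (d1 g (X t) (Y t) * a + d2 g (X t) (Y t) * b)).
    { intros g Hg.
      apply derivable_pt_lim_comp_2d;
        [now apply differentiable_pt_partials | apply HX' | apply HY']. }
    unfold h, h'; apply derivable_pt_lim_plus;
      apply derivable_pt_lim_scal_right, D;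
      [apply Hd1, HX, Ht | apply Hd2, HX, Ht]. }
  assert (HXc : 0 < X c) by (apply HX; lra).
  assert (P := Hpos (X c) (Y c) HXc a b Hne).
  (* [h 1 - h 0] is the increment of the gradient paired with [(a, b)]. *)
  assert (E : 0 < h 1 - h 0) by (rewrite Hc; unfold h'; lra).
  unfold h, X, Y in E.
  replace (x1 + 1 * a) with x2 in E by (unfold a; ring).
  replace (y1 + 1 * b) with y2 in E by (unfold b; ring).
  replace (x1 + 0 * a) with x1 in E by ring.
  replace (y1 + 0 * b) with y1 in E by ring.
  lra.
Qed.

(** * The energy as a function of specific volume and entropy *)

Lemma inv_derivable (v : R) : 0 < v -> derivable_pt_lim Rinv v (- (/ v) ^ 2).
Proof.
  intros Hv; apply is_derive_Reals; auto_derive; [lra | field; lra].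
Qed.

Lemma differentiable_in_specific_volume (g : R -> R -> R) (v eta : R) :
  differentiable_pt g (/ v) eta -> 0 < v ->
  differentiable_pt_lim (in_specific_volume g) v eta
    (- (/ v) ^ 2 * d1 g (/ v) eta) (d2 g (/ v) eta).
Proof.
  intros Hg Hv.
  replace (- (/ v) ^ 2 * d1 g (/ v) eta)
    with (d1 g (/ v) eta * - (/ v) ^ 2 + d2 g (/ v) eta * 0) by ring.
  replace (d2 g (/ v) eta)
    with (d1 g (/ v) eta * 0 + d2 g (/ v) eta * 1) at 2 by ring.
  apply (differentiable_pt_lim_comp g (fun u _ => / u) (fun _ w => w)).
  - now apply differentiable_pt_partials.
  - now apply differentiable_pt_lim_proj1_0, inv_derivable.
  - apply (differentiable_of_C1 _ (fun _ _ => 0)).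
    + apply locally_2d_forall; intros; auto_derive; easy.
    + auto_derive; easy.
    + apply continuity_2d_pt_const.
Qed.

(** Since [d(1 / v) = - rho ^ 2 dv], the factor [rho ^ 2] in the definition of
    the pressure is the one produced by the change of variables. *)
Lemma d1_in_specific_volume (eps : R -> R -> R) (v eta : R) :
  smooth_half_plane eps -> 0 < v ->
  d1 (in_specific_volume eps) v eta = - pressure eps (/ v) eta.
Proof.
  intros Hsmooth Hv.
  assert (Hr := Rinv_0_lt_compat v Hv).
  destruct (differentiable_pt_lim_unique _ _ _ _ _
    (differentiable_in_specific_volume eps v eta
       (smooth_differentiable_pt _ _ _ Hsmooth Hr) Hv)) as [E _].
  unfold d1 at 1; rewrite E; unfold pressure; ring.
Qed.

Lemma d2_in_specific_volume (eps : R -> R -> R) (v eta : R) :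
  d2 (in_specific_volume eps) v eta = temperature eps (/ v) eta.
Proof. reflexivity. Qed.

(** Minus the pressure is the composition of [r, w |-> - r ^ 2 * w] with
    [rho] and [d1 eps]; both functions are continuously differentiable. *)
Lemma differentiable_opp_pressure (eps : R -> R -> R) :
  smooth_half_plane eps -> forall rho eta : R, 0 < rho ->
  differentiable_pt (fun r s => - pressure eps r s) rho eta.
Proof.
  intros Hsmooth rho eta Hr; unfold pressure.
  eexists; eexists.
  apply (differentiable_pt_lim_comp (fun r w => - (r ^ 2 * w))
           (fun r _ => r) (d1 eps)).
  - apply (differentiable_of_C1 _ (fun r w => - (2 * r * w))).
    + apply locally_2d_forall; intros; auto_derive; [easy | ring].
    + auto_derive; [easy | reflexivity].
    + repeat first [ apply continuity_2d_pt_opp | apply continuity_2d_pt_mult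
        | apply continuity_2d_pt_const | apply continuity_2d_pt_id1
        | apply continuity_2d_pt_id2 ].
  - apply differentiable_pt_lim_proj1_0, derivable_pt_lim_id.
  - now apply smooth_differentiable; [apply smooth_d1 |].
Qed.

Lemma differentiable_d1_in_specific_volume (eps : R -> R -> R) :
  smooth_half_plane eps -> forall v eta : R, 0 < v ->
  differentiable_pt (d1 (in_specific_volume eps)) v eta.
Proof.
  intros Hsmooth v eta Hv.
  apply (differentiable_pt_ext_half_plane
           (in_specific_volume (fun r s => - pressure eps r s))).
  - intros u w Hu; now rewrite d1_in_specific_volume.
  - exact Hv.
  - eexists; eexists; apply differentiable_in_specific_volume; [| exact Hv].
    now apply differentiable_opp_pressure, Rinv_0_lt_compat.
Qed.

Lemma differentiable_d2_in_specific_volume (eps : R -> R -> R) :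
  smooth_half_plane eps -> forall v eta : R, 0 < v ->
  differentiable_pt (d2 (in_specific_volume eps)) v eta.
Proof.
  intros Hsmooth v eta Hv.
  eexists; eexists.
  apply (differentiable_in_specific_volume (d2 eps)); [| exact Hv].
  now apply smooth_differentiable_pt; [apply smooth_d2 | apply Rinv_0_lt_compat].
Qed.

(** Two distinct points [(v, eta)] with equal gradients would make the strictly
    positive quantity of [gradient_strictly_monotone] vanish. *)
Lemma density_entropy_of_pressure_temperature (eps : R -> R -> R) :
  specific_internal_energy eps ->
  forall rho1 eta1 rho2 eta2 : R, 0 < rho1 -> 0 < rho2 ->
    pressure eps rho1 eta1 = pressure eps rho2 eta2 ->
    temperature eps rho1 eta1 = temperature eps rho2 eta2 ->
    rho1 = rho2 /\ eta1 = eta2.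
Proof.
  intros [Hs _ Hpos _] rho1 eta1 rho2 eta2 H1 H2 Ep Et.
  assert (Hv1 := Rinv_0_lt_compat _ H1).
  assert (Hv2 := Rinv_0_lt_compat _ H2).
  assert (M := gradient_strictly_monotone (in_specific_volume eps)
    (differentiable_d1_in_specific_volume eps Hs)
    (differentiable_d2_in_specific_volume eps Hs) Hpos
    (/ rho1) eta1 (/ rho2) eta2 Hv1 Hv2).
  rewrite !d1_in_specific_volume, !d2_in_specific_volume, !Rinv_inv, Ep, Et in M
    by assumption.
  destruct (Req_dec (/ rho1) (/ rho2)) as [Ev | Nv];
    [destruct (Req_dec eta1 eta2) as [Ee | Ne] |].
  - split; [now apply Rinv_eq_reg | exact Ee].
  - exfalso; assert (0 < 0); [| lra].
    eapply Rlt_le_trans; [apply M; intros E; injection E; lra | lra].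
  - exfalso; assert (0 < 0); [| lra].
    eapply Rlt_le_trans; [apply M; intros E; injection E; lra | lra].
Qed.

(** * Discontinuities without mass flux *)

Lemma mass_flux_eq_0 (D : R) (S : state) :
  0 < density S -> mass_flux D S = 0 -> velocity S = D.
Proof.
  unfold mass_flux; intros Hd H.
  apply Rmult_integral in H; lra.
Qed.

Lemma states_eq_of_zero_mass_flux (kappa : R) (eps : R -> R -> R) (D : R)
    (SL SR : state) :
  kappa <> 0 -> specific_internal_energy eps ->
  0 < density SL -> 0 < density SR ->
  rankine_hugoniot kappa eps D SL SR ->
  mass_flux D SL = 0 -> mass_flux D SR = 0 -> SL = SR.
Proof.
  intros Hk Heps HL HR (_ & Hmom & Hj & Hen) ML MR.
  assert (UL := mass_flux_eq_0 D SL HL ML).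
  assert (UR := mass_flux_eq_0 D SR HR MR).
  unfold jump, momentum_flux, j_flux, energy_flux in Hmom, Hj, Hen.
  rewrite ML, MR in Hmom, Hj, Hen.
  unfold Rdiv in Hmom; rewrite pow_i, !Rmult_0_l in Hmom by auto.
  rewrite !Rmult_0_l in Hj, Hen.
  clear ML MR.
  destruct SL as [rL uL eL jL], SR as [rR uR eR jR].
  unfold pressure_of, temperature_of in *; simpl in *.
  destruct (density_entropy_of_pressure_temperature eps Heps rL eL rR eR)
    as [Er Ee]; [assumption | assumption | lra | lra |].
  subst rR eR uL uR.
  assert (T := energy_temperature eps Heps rL eL HL).
  (* The energy condition now says that [kappa ^ 2 / rho * theta], which is
     nonzero, has the same product with [jL] and [jR]. *)
  f_equal; apply (Rmult_eq_reg_l (kappa ^ 2 / rL * temperature eps rL eL));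
    [lra |].
  repeat apply Rmult_integral_contrapositive_currified; try lra.
  now apply Rinv_neq_0_compat, Rgt_not_eq.
Qed.

Theorem mainTheorem5 (kappa : R) (eps : R -> R -> R)
    (hkappa : kappa <> 0) (heps : specific_internal_energy eps) :
  (forall (D : R) (SL SR : state),
     0 < density SL -> 0 < density SR ->
     rankine_hugoniot kappa eps D SL SR ->
     mass_flux D SL = 0 -> mass_flux D SR = 0 ->
     jump density SL SR = 0 /\ jump velocity SL SR = 0 /\
     jump entropy SL SR = 0 /\ jump thermal_j SL SR = 0)
  /\
  ~ (exists (D : R) (SL SR : state),
       0 < density SL /\ 0 < density SR /\
       rankine_hugoniot kappa eps D SL SR /\
       contact_discontinuity D SL SR).
Proof.
  split.
  - intros D SL SR HL HR HRH ML MR.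
    rewrite (states_eq_of_zero_mass_flux kappa eps D SL SR) by assumption.
    unfold jump; repeat split; apply Rminus_diag_eq; reflexivity.
  - intros (D & SL & SR & HL & HR & HRH & Hne & ML & MR).
    now apply Hne, (states_eq_of_zero_mass_flux kappa eps D).
Qed.
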